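(* Let $J_1,J_2,J_3$ be nonempty finite trees, let $\Delta$ be a $(J_2,J_1)$-bi-tree and $\Gamma$ a $(J_3,J_2)$-bi-tree. Then the gluing procedure described in the context, applied to $\Delta$ and $\Gamma$, gives a $(J_3,J_1)$-bi-tree (denoted $\Delta\diamond\Gamma$).
   Context: Let $I,J$ be nonempty finite trees. Let $\Gamma$ be a finite graph whose edges are colored black, blue, and red, equipped with embeddings $\imath:I\to\Gamma$, $\jmath:J\to\Gamma$. Denote by $\Gamma^{black}_{blue}$ the subgraph consisting of black and blue edges, by $\Gamma^{black}_{red}$ the subgraph consisting of black and red edges. $(\Gamma,\imath,\jmath)$ is an $(I,J)$-bi-tree if: the subgraphs $\Gamma^{black}_{blue}$ and $\Gamma^{black}_{red}$ are trees; $\imath(I)\subset\Gamma^{black}_{blue}$, $\jmath(J)\subset\Gamma^{black}_{red}$; any vertex of $\Gamma$ of valence 1 is an end of a black edge contained in $\imath(I)$ or $\jmath(J)$. Gluing procedure: glue $\Gamma$ and $\Delta$ identifying the images of the embeddings $J_2\to\Gamma$, $J_2\to\Delta$ (in $\Delta$ the image lies in the black-blue tree, in $\Gamma$ in the black-red tree). After this, edges of $J_2$ can carry double colors. Replace ($\Delta$-blue, $\Gamma$-black) $\to$ blue, ($\Delta$-black, $\Gamma$-red) $\to$ red, ($\Delta$-black, $\Gamma$-black) $\to$ black, and remove ($\Delta$-blue, $\Gamma$-red)-edges (other combinations of colors on edges of $J_2$ are impossible). Finally, remove all vertices of valence 1 that are not contained in the images of $J_1$ and $J_3$ (such vertices are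 automatically contained in $J_2$ and the adjacent edges are black); repeat this step again, etc. The resulting graph carries the embeddings of $J_3$ (from $\Gamma$) and of $J_1$ (from $\Delta$).
   Formalization: A valence-1 vertex must be an end of a black edge and itself lie in the image of I or J; the edge need not lie there, since that fails for one-point J1, J3. Graphs may have parallel edges, and the two colored subgraphs keep all vertices. *)

(* Defs.v *)
From mathcomp Require Import all_boot.

Set Implicit Arguments.
Unset Strict Implicit.
Unset Printing Implicit Defensive.

(** Parallel edges are allowed: gluing may produce a blue and a red edge with
    the same ends.  Loops are excluded; no loop can occur in a bi-tree, since
    each edge lies in one of its two trees. *)
Record mgraph := MGraph {
  vert : finType;
  edge : finType;
  ends : edge -> {set vert};
  card_ends : forall e, #|ends e| = 2
}.

Definition adj (G : mgraph) : rel (vert G) :=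
  fun x y => [exists e : edge G, ends e == [set x; y]].

Definition connected (G : mgraph) : Prop :=
  forall x y : vert G, connect (@adj G) x y.

(** A walk from [x] is the list of its successive steps
    (edge taken, vertex reached). *)
Fixpoint walk (G : mgraph) (x : vert G) (p : seq (edge G * vert G)) : bool :=
  if p is (e, y) :: p' then (ends e == [set x; y]) && walk y p' else true.

Definition is_cycle (G : mgraph) (x : vert G) (p : seq (edge G * vert G)) :=
  [&& p != [::], walk x p, last x (unzip2 p) == x,
      uniq (unzip1 p) & uniq (unzip2 p)].

Definition acyclic (G : mgraph) : Prop :=
  forall (x : vert G) (p : seq (edge G * vert G)), ~~ is_cycle x p.

(** The empty graph counts as a tree; nonemptiness is stated separately. *)
Definition is_tree (G : mgraph) : Prop := connected G /\ acyclic G.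

Definition valence (G : mgraph) (v : vert G) : nat :=
  #|[set e : edge G | v \in ends e]|.

Section EdgeSub.
Variables (G : mgraph) (A : {pred edge G}).

Definition edge_sub : mgraph :=
  @MGraph (vert G) {e : edge G | e \in A}
    (fun e => ends (val e)) (fun e => card_ends (val e)).

End EdgeSub.

Section VertexSub.
Variables (G : mgraph) (W : {set vert G}).

Definition vsub_ends (e : {e : edge G | ends e \subset W}) :
  {set {x : vert G | x \in W}} := [set x | val x \in ends (val e)].

Lemma card_vsub_ends e : #|vsub_ends e| = 2.
Proof.
rewrite -(card_ends (val e)) -(card_imset _ val_inj); apply: eq_card => x.
apply/imsetP/idP => [[y + ->]|xe]; first by rewrite inE.
have xW : x \in W by apply: subsetP xe; exact: (valP e).
by exists (exist _ x xW); rewrite ?inE.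
Qed.

Definition vertex_sub : mgraph := MGraph card_vsub_ends.

End VertexSub.

Record emb (I G : mgraph) := Emb {
  embV : vert I -> vert G;
  embE : edge I -> edge G;
  embV_inj : injective embV;
  embE_inj : injective embE;
  emb_ends : forall e, ends (embE e) = embV @: ends e
}.

Section EmbComp.
Variables (I G H : mgraph) (f : emb G H) (g : emb I G).

Lemma emb_comp_ends e :
  ends ((embE f \o embE g) e) = (embV f \o embV g) @: ends e.
Proof. by rewrite /= !emb_ends imset_comp. Qed.

Definition emb_comp : emb I H :=
  Emb (inj_comp (@embV_inj _ _ f) (@embV_inj _ _ g))
      (inj_comp (@embE_inj _ _ f) (@embE_inj _ _ g)) emb_comp_ends.

End EmbComp.

Section EmbEdgeSub.
Variables (I G : mgraph) (f : emb I G) (A : {pred edge G}).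
Hypothesis fA : forall e, embE f e \in A.

Definition esubE (e : edge I) : edge (edge_sub A) := exist _ (embE f e) (fA e).

Lemma esubE_inj : injective esubE.
Proof. by move=> e e' /(congr1 val) /=; apply: embE_inj. Qed.

Definition emb_edge_sub : emb I (edge_sub A) :=
  @Emb I (edge_sub A) (embV f) esubE (@embV_inj _ _ f) esubE_inj
    (@emb_ends _ _ f).

End EmbEdgeSub.

Section EmbVertexSub.
Variables (I G : mgraph) (f : emb I G) (W : {set vert G}).
Hypothesis fW : forall x, embV f x \in W.

Lemma vsub_subset e : ends (embE f e) \subset W.
Proof. by rewrite emb_ends; apply/subsetP => _ /imsetP[x _ ->]. Qed.

Definition vsubV (x : vert I) : vert (vertex_sub W) := exist _ (embV f x) (fW x).
Definition vsubE (e : edge I) : edge (vertex_sub W) :=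
  exist _ (embE f e) (vsub_subset e).

Lemma vsubV_inj : injective vsubV.
Proof. by move=> x x' /(congr1 val) /=; apply: embV_inj. Qed.

Lemma vsubE_inj : injective vsubE.
Proof. by move=> e e' /(congr1 val) /=; apply: embE_inj. Qed.

Lemma vsub_emb_ends e : ends (vsubE e) = vsubV @: ends e.
Proof.
apply/setP => x; rewrite inE /= emb_ends.
apply/imsetP/imsetP => -[y ye yx]; exists y => //; last by rewrite yx.
exact: val_inj.
Qed.

Definition emb_vertex_sub : emb I (vertex_sub W) :=
  Emb vsubV_inj vsubE_inj vsub_emb_ends.

End EmbVertexSub.

Inductive color := Black | Blue | Red.

Definition black_or_blue (c : color) := if c is Red then false else true.
Definition black_or_red (c : color) := if c is Blue then false else true.

Record bigraph (I J : mgraph) := BiGraph {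
  bg : mgraph;
  col : edge bg -> color;
  iota : emb I bg;
  jota : emb J bg
}.

Section BiTree.
Variables (I J : mgraph) (G : bigraph I J).

(** Both subgraphs keep all the vertices of the graph.  In particular a vertex
    without edges is a tree, and the inclusion of [iota I] in the black-blue
    subgraph only constrains the edges. *)
Definition black_blue : mgraph :=
  edge_sub [pred e : edge (bg G) | black_or_blue (col e)].
Definition black_red : mgraph :=
  edge_sub [pred e : edge (bg G) | black_or_red (col e)].

(** In [bitree_leaf] it is the end [v], not the black edge, that lies in the
    image of [I] or [J]: a black path whose two ends are the images of
    one-point trees [I] and [J] is a bi-tree. *)
Record is_bitree : Prop := IsBiTree {
  bitree_black_blue : is_tree black_blue;
  bitree_black_red : is_tree black_red;
  bitree_iota : forall e, black_or_blue (col (embE (iota G) e));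
  bitree_jota : forall e, black_or_red (col (embE (jota G) e));
  bitree_leaf : forall v : vert (bg G), valence v = 1 ->
    (exists2 e : edge (bg G), v \in ends e & col e = Black) /\
    (v \in codom (embV (iota G)) \/ v \in codom (embV (jota G)))
}.

End BiTree.

Record bitree (I J : mgraph) := BiTree {
  bt :> bigraph I J;
  bitreeP : is_bitree bt
}.

(** For injective [f] and [g], a model of the disjoint union of [X] and [Y] in
    which [f a] and [g a] are identified: all of [Y], and the part of [X]
    outside the image of [f]; see [po_glue], [po_surj] and [po_eq]. *)
Section Pushout.
Variables (A X Y : finType) (f : A -> X) (g : A -> Y).

Definition pushout : finType := (Y + {x : X | x \notin codom f})%type.

Definition po_inr (y : Y) : pushout := inl y.

Definition po_inl (x : X) : pushout :=
  match boolP (x \in codom f) with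
  | AltTrue fx => inl (g (iinv fx))
  | AltFalse nfx => inr (exist _ x nfx)
  end.

Lemma po_inr_inj : injective po_inr.
Proof. by move=> y y' []. Qed.

Hypotheses (f_inj : injective f) (g_inj : injective g).

Lemma po_glue a : po_inl (f a) = po_inr (g a).
Proof.
rewrite /po_inl; case: {-}_ / boolP => [fx|nfx]; last by case/negP: (nfx); apply: codom_f.
by congr (inl (g _)); apply: f_inj; rewrite f_iinv.
Qed.

Lemma po_inl_inj : injective po_inl.
Proof.
move=> x x'; rewrite /po_inl.
case: {-}_ / boolP => fx; case: {-}_ / boolP => fx' //.
  by case=> /g_inj e; rewrite -(f_iinv fx) e f_iinv.
by case.
Qed.

Lemma po_surj (u : pushout) :
  (exists x, u = po_inl x) \/ (exists y, u = po_inr y).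
Proof.
case: u => [y|[x nfx]]; [by right; exists y | left; exists x].
rewrite /po_inl; case: {-}_ / boolP => [fx|nfx']; first by case/negP: (nfx).
by congr inr; apply: val_inj.
Qed.

Lemma po_eq x y : po_inl x = po_inr y -> exists2 a, x = f a & y = g a.
Proof.
rewrite /po_inl; case: {-}_ / boolP => // fx [<-].
by exists (iinv fx); rewrite ?f_iinv.
Qed.

End Pushout.

Section Glue.
Variables (J X Y : mgraph) (f : emb J X) (g : emb J Y).

Let inlV := po_inl (embV f) (embV g).
Let inrV := @po_inr _ (vert X) _ (embV f : vert J -> vert X) : vert Y -> _.
Let inlE := po_inl (embE f) (embE g).
Let inrE := @po_inr _ (edge X) _ (embE f : edge J -> edge X) : edge Y -> _.

Definition glue_ends (e : pushout (edge Y) (embE f)) :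
    {set pushout (vert Y) (embV f)} :=
  match e with
  | inl y => inrV @: ends y
  | inr x => inlV @: ends (val x)
  end.

Lemma card_glue_ends e : #|glue_ends e| = 2.
Proof.
case: e => [y|[x nx]] /=; rewrite card_imset ?card_ends //.
  exact: po_inr_inj.
by apply: po_inl_inj; apply: embV_inj.
Qed.

Definition glue : mgraph := MGraph card_glue_ends.

Lemma glue_inl_ends (e : edge X) : glue_ends (inlE e) = inlV @: ends e.
Proof.
rewrite /inlE /po_inl; case: {-}_ / boolP => [fe|nfe] //=.
rewrite -[in RHS](f_iinv fe) !emb_ends -!imset_comp.
by apply: eq_imset => a /=; rewrite /inlV po_glue //; apply: embV_inj.
Qed.

Definition glue_inl : emb X glue :=
  @Emb X glue inlV inlE
    (po_inl_inj (@embV_inj _ _ g)) (po_inl_inj (@embE_inj _ _ g)) glue_inl_ends.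

Definition glue_inr : emb Y glue :=
  @Emb Y glue inrV inrE (@po_inr_inj _ _ _ _) (@po_inr_inj _ _ _ _)
    (fun=> erefl).

End Glue.

Section Prune.
Variables (G : mgraph) (P : {set vert G}).

Definition valence_in (W : {set vert G}) (v : vert G) : nat :=
  #|[set e : edge G | (v \in ends e) && (ends e \subset W)]|.

Definition prune_step (W : {set vert G}) : {set vert G} :=
  [set v in W | ~~ ((v \notin P) && (valence_in W v == 1))].

(** [#|vert G|] rounds are enough to reach stability, see [prune_stable]. *)
Definition prune : {set vert G} := iter #|vert G| prune_step setT.

Lemma prune_stable : prune_step prune = prune.
Proof.
have sub W : prune_step W \subset W by apply/subsetP => v; rewrite inE => /andP[].
suff H n : prune_step (iter n prune_step setT) = iter n prune_step setT \/
    #|iter n prune_step setT| + n <= #|vert G|.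
  case: (H #|vert G|) => //; rewrite -[leqRHS]add0n leq_add2r leqn0.
  rewrite cards_eq0 -/prune => /eqP->; apply/eqP.
  by rewrite -subset0 sub.
elim: n => [|n [IH|IH]] /=; [by right; rewrite cardsT addn0 | by left; rewrite !IH |].
set W := iter n _ _ in IH *.
have [eqW|neq] := eqVneq (prune_step W) W; [by left; rewrite eqW|right].
rewrite addnS; apply: leq_trans IH; rewrite -addSn leq_add2r.
by apply: proper_card; rewrite properEneq neq sub.
Qed.

Lemma sub_prune v : v \in P -> v \in prune.
Proof.
by move=> vP; rewrite /prune; elim: #|_| => [|n IH] /=; rewrite !inE ?IH ?vP.
Qed.

End Prune.

(** Color of an edge carried by both graphs, the [Delta]-color coming first;
    [None] means that the edge is removed.  Only the first four combinations
    can occur. *)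
Definition merge_color (cD cG : color) : option color :=
  match cD, cG with
  | Blue, Black => Some Blue
  | Black, Red => Some Red
  | Black, Black => Some Black
  | Blue, Red => None
  | _, _ => None
  end.

Section Diamond.
Variables (J1 J2 J3 : mgraph) (Delta : bitree J2 J1) (Gamma : bitree J3 J2).

Definition glued : mgraph := glue (iota Delta) (jota Gamma).
Definition inDelta : emb (bg Delta) glued := glue_inl (iota Delta) (jota Gamma).
Definition inGamma : emb (bg Gamma) glued := glue_inr (iota Delta) (jota Gamma).

Definition Delta_color (e : edge glued) : option color :=
  omap (@col _ _ Delta) [pick d | embE inDelta d == e].
Definition Gamma_color (e : edge glued) : option color :=
  omap (@col _ _ Gamma) [pick c | embE inGamma c == e].

Definition glued_color (e : edge glued) : option color :=
  match Delta_color e, Gamma_color e with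
  | Some cD, Some cG => merge_color cD cG
  | Some c, None | None, Some c => Some c
  | None, None => None
  end.

Definition recolored : mgraph := edge_sub [pred e | isSome (glued_color e)].

Lemma Delta_colorE d : Delta_color (embE inDelta d) = Some (col d).
Proof.
rewrite /Delta_color; case: pickP => [d' /eqP/embE_inj->|/(_ d)] //.
by rewrite eqxx.
Qed.

Lemma Gamma_colorE c : Gamma_color (embE inGamma c) = Some (col c).
Proof.
rewrite /Gamma_color; case: pickP => [c' /eqP/embE_inj->|/(_ c)] //.
by rewrite eqxx.
Qed.

Lemma glued_overlap d c : embE inDelta d = embE inGamma c ->
  black_or_blue (col d) /\ black_or_red (col c).
Proof.
move=> /po_eq[a -> ->]; split.
  exact: (bitree_iota (bitreeP Delta)).
exact: (bitree_jota (bitreeP Gamma)).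
Qed.

Definition iota_glued : emb J3 glued := emb_comp inGamma (iota Gamma).
Definition jota_glued : emb J1 glued := emb_comp inDelta (jota Delta).

Lemma iota_kept e : embE iota_glued e \in [pred e | isSome (glued_color e)].
Proof.
rewrite inE /glued_color Gamma_colorE /Delta_color.
case: pickP => //= d /eqP /glued_overlap[].
move: (bitree_iota (bitreeP Gamma) e).
by case: (col (embE _ e)); case: (col d).
Qed.

Lemma jota_kept e : embE jota_glued e \in [pred e | isSome (glued_color e)].
Proof.
rewrite inE /glued_color Delta_colorE /Gamma_color.
case: pickP => //= c /eqP /esym /glued_overlap[].
move: (bitree_jota (bitreeP Delta) e).
by case: (col (embE _ e)); case: (col c).
Qed.

Definition iota_recolored : emb J3 recolored := emb_edge_sub iota_kept.
Definition jota_recolored : emb J1 recolored := emb_edge_sub jota_kept.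

Definition protected : {set vert recolored} :=
  [set v | (v \in codom (embV iota_recolored)) ||
           (v \in codom (embV jota_recolored))].

Lemma iota_pruned x : embV iota_recolored x \in prune protected.
Proof. by apply: sub_prune; rewrite inE codom_f. Qed.

Lemma jota_pruned x : embV jota_recolored x \in prune protected.
Proof. by apply: sub_prune; rewrite inE codom_f orbT. Qed.

(** The default color is never used: all remaining edges have a color. *)
Definition diamond : bigraph J3 J1 :=
  @BiGraph J3 J1 (vertex_sub (prune protected))
    (fun e => odflt Black (glued_color (val (val e))))
    (emb_vertex_sub iota_pruned) (emb_vertex_sub jota_pruned).

End Diamond.

(* Main.v *)
(** A nonempty connected graph is acyclic iff it has exactly one edge fewer than
    vertices.  The black-blue part of the glued graph is the black-blue tree of
    [Gamma] together with the edges of the black-blue tree of [Delta] outside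
    [J2]; it is connected, because an omitted edge of [J2] can be bypassed in
    the tree of [Gamma], and counting edges shows that it is a tree.  The
    black-red part is symmetric.  A path between two surviving vertices never
    visits a pruned one, as its inner vertices have valence at least two; so
    pruning preserves connectedness.  Finally, the only edge at a vertex of
    valence 1 belongs to both trees, hence is black. *)

Require Import Defs.
From mathcomp Require Import all_boot zify.

Set Implicit Arguments.
Unset Strict Implicit.
Unset Printing Implicit Defensive.

(** * Adjacency and paths in edge subgraphs *)

Lemma adjP (G : mgraph) (x y : vert G) :
  reflect (exists e, ends e = [set x; y]) (adj x y).
Proof.
by apply: (iffP existsP) => -[e]; [move/eqP|move=> <-]; exists e.
Qed.

Lemma adj_edge_subP (G : mgraph) (A : {pred edge G}) (x y : vert G) :
  reflect (exists2 e, e \in A & ends e = [set x; y]) (@adj (edge_sub A) x y).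
Proof.
apply: (iffP (adjP _ _)) => [[[e eA] /= <-]|[e eA exy]]; first by exists e.
by exists (exist _ e eA).
Qed.

Lemma adj_sym (G : mgraph) : symmetric (@adj G).
Proof. by move=> x y; rewrite /adj setUC. Qed.

Lemma adj_connect_sym (G : mgraph) : connect_sym (@adj G).
Proof. exact/sym_connect_sym/adj_sym. Qed.

Lemma connect_edge_sub_sym (G : mgraph) (A : {pred edge G}) (x y : vert G) :
  connect (@adj (edge_sub A)) x y = connect (@adj (edge_sub A)) y x.
Proof. exact: (@adj_connect_sym (edge_sub A)). Qed.

Lemma connect_homo (T T' : finType) (f : T -> T') (e : rel T) (e' : rel T') :
  {homo f : x y / e x y >-> connect e' x y} ->
  {homo f : x y / connect e x y >-> connect e' x y}.
Proof.
move=> fe x y /connectP[p + ->]; elim: p x => //= z p IH x /andP[/fe xz /IH].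
exact: connect_trans.
Qed.

(** Without a crossing edge, [W] would be closed under adjacency and would contain [y] along with
    [x]. *)
Lemma connected_crossing (G : mgraph) (W : {set vert G}) (x y : vert G) :
  connected G -> x \in W -> y \notin W ->
  exists x' y' (e : edge G), [/\ x' \in W, y' \notin W & ends e = [set x'; y']].
Proof.
move=> cG xW yW.
have [/existsP[x' /andP[x'W /existsP[y' /andP[y'W /adjP[e]]]]]|] :=
  boolP [exists x' in W, exists y', (y' \notin W) && adj x' y'].
  by exists x', y', e.
rewrite negb_exists => /forallP noE; case/negP: yW.
suff clW : closed (@adj G) W by rewrite -(closed_connect clW (cG x y)).
apply: intro_closed => [|x' y' x'y' x'W]; first exact: adj_connect_sym.
move: (noE x'); rewrite x'W negb_exists /= => /forallP /(_ y').
by rewrite x'y' andbT negbK.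
Qed.

(** * Spanning edge sets and the edge count of a tree *)

(** A spanning tree is grown from a root, one crossing edge at a time. Both directions of the
    edge-count criterion for acyclicity rest on it. *)
Lemma spanning_edges (G : mgraph) :
  connected G -> 0 < #|vert G| ->
  exists2 A : {set edge G}, connected (edge_sub A) & #|A|.+1 = #|vert G|.
Proof.
move=> cG /card_gt0P[r _].
(* The edges stay inside [W], so that an edge leaving [W] is always a new one. *)
have grow k : k < #|vert G| -> exists (W : {set vert G}) (A : {set edge G}),
    [/\ #|W| = k.+1, #|A| = k, forall e, e \in A -> ends e \subset W &
        forall x, x \in W -> connect (@adj (edge_sub A)) r x].
  elim: k => [|k IH] ltkV.
    exists [set r], set0; rewrite cards1 cards0; split=> // [e|x].
      by rewrite inE.
    by rewrite inE => /eqP->.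
  have [W [A [cW cA AW Wr]]] := IH (ltnW ltkV).
  have [y yW] : exists y, y \notin W.
    apply/existsP; rewrite -negb_forall; apply/negP => /forallP allW.
    have : #|vert G| <= #|W| by apply/subset_leq_card/subsetP => z _.
    by rewrite cW leqNgt ltkV.
  (* The root lies in [W]: a path from [r] to a point of [W] is either empty or starts with an edge
     of [A], whose ends are in [W]. *)
  have [rW|rW] := boolP (r \in W); last first.
    have /card_gt0P[z zW] : 0 < #|W| by rewrite cW.
    have /connectP[[|w p] /=] := Wr z zW.
      by move=> _ E; rewrite -E zW in rW.
    case/andP => /adj_edge_subP[e /AW/subsetP eW E] _ _.
    by rewrite eW ?E ?inE ?eqxx in rW.
  have [x' [y' [e [x'W y'W exy]]]] := connected_crossing cG rW yW.
  have enA : e \notin A.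
    apply/negP => /AW/subsetP/(_ y'); rewrite exy !inE eqxx orbT.
    by move=> /(_ isT); apply/negP.
  exists (y' |: W), (e |: A); rewrite !cardsU1 enA y'W cW cA; split=> //.
    move=> e'; rewrite !inE => /orP[/eqP->|/AW/subset_trans]; last first.
      by apply; apply: subsetUr.
    rewrite exy; apply/subsetP => z; rewrite !inE.
    by case/orP => [/eqP->|->//]; rewrite x'W orbT.
  have Wr' x : x \in W -> connect (@adj (edge_sub (e |: A))) r x.
    move=> /Wr; apply: connect_sub => u v /adj_edge_subP[e' e'A E].
    by apply/connect1/adj_edge_subP; exists e'; rewrite // !inE e'A orbT.
  move=> x; rewrite !inE => /orP[/eqP->|/Wr'//].
  apply: connect_trans (Wr' _ x'W) (connect1 _).
  by apply/adj_edge_subP; exists e; rewrite // !inE eqxx.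
have V0 : 0 < #|vert G| by apply/card_gt0P; exists r.
have [|W [A [cW cA _ Wr]]] := grow #|vert G|.-1; first by rewrite prednK.
rewrite prednK // in cW; exists A; last by rewrite cA prednK.
have /eqP WT : W == setT by rewrite eqEcard subsetT cardsT cW /=.
move=> x y; apply: (@connect_trans _ _ r); last by apply: Wr; rewrite WT inE.
by rewrite connect_edge_sub_sym; apply: Wr; rewrite WT inE.
Qed.

Lemma walk_ends (G : mgraph) (x : vert G) q e :
  walk x q -> e \in unzip1 q -> {subset ends e <= x :: unzip2 q}.
Proof.
elim: q x => //= -[e' y] q IH x /= /andP[/eqP exy wq]; rewrite inE.
case/orP => [/eqP-> z|eq z ze]; last by rewrite inE (IH y) ?orbT.
by rewrite exy !inE orbA => ->.
Qed.

(** Taking the first edge a second time would lead back to the starting vertex [x]. This supplies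
    the edge condition of [is_cycle] for simple paths. *)
Lemma walk_uniq_edges (G : mgraph) (x : vert G) q :
  walk x q -> uniq (x :: unzip2 q) -> uniq (unzip1 q).
Proof.
elim: q x => //= -[e y] q IH x /= /andP[/eqP exy wq] /andP[xq uq].
rewrite (IH y) // andbT; apply/negP => eq; case/negP: xq.
by apply: (walk_ends wq eq); rewrite exy !inE eqxx.
Qed.

Lemma path_edge_sub (G : mgraph) (A : {pred edge G}) (x : vert G) p :
  path (@adj (edge_sub A)) x p ->
  exists2 q, walk x q & unzip2 q = p /\ {subset unzip1 q <= A}.
Proof.
elim: p x => [|y p IH] x /=; first by exists [::].
case/andP => /adj_edge_subP[e eA exy] /IH[q wq [<- qA]].
exists ((e, y) :: q); rewrite /= ?exy ?eqxx //; split=> // e'.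
by rewrite inE => /orP[/eqP->|/qA].
Qed.

Lemma walk_connect (G : mgraph) (A : {pred edge G}) (x : vert G) q :
  walk x q -> {subset unzip1 q <= A} ->
  connect (@adj (edge_sub A)) x (last x (unzip2 q)).
Proof.
elim: q x => //= -[e y] q IH x /= /andP[/eqP exy wq] qA.
apply: connect_trans (IH y wq _) => [|e' e'q]; last first.
  by apply: qA; rewrite inE e'q orbT.
by apply/connect1/adj_edge_subP; exists e => //; apply: qA; rewrite inE eqxx.
Qed.

(** A spanning set from [spanning_edges] must contain every edge: a missing one would close a
    cycle. *)
Lemma tree_card (G : mgraph) :
  is_tree G -> 0 < #|vert G| -> #|edge G|.+1 = #|vert G|.
Proof.
move=> [cG aG] /(spanning_edges cG)[A cA <-].
suff -> : A = setT by rewrite cardsT.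
apply/setP => e; rewrite !inE; apply/negPn/negP => enA.
have /cards2P[x [y [xy exy]]] : #|ends e| == 2 by rewrite card_ends.
(* A simple path in [A] from [y] back to [x], preceded by the missing edge [e], is a cycle. *)
have /connectP[p pp xp] := cA y x.
case/shortenP: pp xp => p' /path_edge_sub[q wq [<- qA]] up _ xq.
case/negP: (aG x ((e, y) :: q)); apply/and5P; split=> //=.
- by rewrite exy eqxx.
- by rewrite -xq.
- rewrite (walk_uniq_edges wq up) andbT; apply/negP => /qA.
  exact/negP.
Qed.

(** Deleting an edge of a cycle keeps the graph connected, but leaves too few edges to span it. *)
Lemma acyclic_card (G : mgraph) :
  connected G -> #|edge G| < #|vert G| -> acyclic G.
Proof.
move=> cG ltEV x [|[e y] q]; apply/negP => /and5P[] //=.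
move=> _ /andP[/eqP exy wq] /eqP xq /andP[eq _] _.
pose A := predC1 e.
(* The rest of the cycle is a detour around [e]. *)
have yx : connect (@adj (edge_sub A)) y x.
  rewrite -xq; apply: walk_connect => // e' e'q; rewrite !inE.
  by apply: contra eq => /eqP <-.
have cA : connected (edge_sub A).
  move=> u v; apply: connect_sub (cG u v) => {}u {}v /adjP[e' e'uv].
  have [ee'|ne] := eqVneq e' e; last first.
    by apply/connect1/adj_edge_subP; exists e'.
  have : v \in ends e' by rewrite e'uv !inE eqxx orbT.
  have : u \in ends e' by rewrite e'uv !inE eqxx.
  rewrite ee' exy !inE.
  case/orP => /eqP-> /orP[]/eqP->; rewrite ?connect0 //.
  by rewrite connect_edge_sub_sym.
(* The spanning set [B] avoids [e], so [#|vert G| = #|B|.+1 <= #|edge G|], against [ltEV]. *)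
have [|B _ cB] := spanning_edges cA; first exact: leq_ltn_trans ltEV.
have := max_card (mem B); rewrite /= card_sig cardC1 => leB.
have E0 : 0 < #|edge G| by apply/card_gt0P; exists e.
move: ltEV; rewrite -[#|vert G|]cB ltnS => ltEV.
by have := leq_trans ltEV leB; rewrite -ltnS prednK // ltnn.
Qed.

Lemma acyclic_emb (G H : mgraph) (f : emb G H) : acyclic H -> acyclic G.
Proof.
move=> aH x p; apply/negP => /and5P[p0 wp /eqP lp u1 u2].
pose fp := [seq (embE f s.1, embV f s.2) | s <- p].
have fp1 : unzip1 fp = map (embE f) (unzip1 p) by rewrite /unzip1 -!map_comp.
have fp2 : unzip2 fp = map (embV f) (unzip2 p) by rewrite /unzip2 -!map_comp.
case/negP: (aH (embV f x) fp); apply/and5P; split.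
- by move: p0; rewrite /fp -!size_eq0 size_map.
- rewrite /fp; elim: p x wp {p0 lp u1 u2 fp fp1 fp2} => //= -[e y] p IH x /=.
  by case/andP => /eqP exy /IH->; rewrite emb_ends exy imsetU1 imset_set1 eqxx.
- by rewrite fp2 last_map lp.
- by rewrite fp1 map_inj_uniq //; apply: embE_inj.
- by rewrite fp2 map_inj_uniq //; apply: embV_inj.
Qed.

(** * Two trees glued along a common subtree *)

(** The graph [H] is the union of copies of [X] and [Y] along [J], and [C]
    consists of the tree [B] of [Y] and of the edges of the tree [A] of [X]
    outside [J]. *)
Lemma glue_tree (J X Y H : mgraph) (f : emb J X) (g : emb J Y)
    (i : emb X H) (j : emb Y H)
    (A : {pred edge X}) (B : {pred edge Y}) (C : {pred edge H}) :
  is_tree J -> 0 < #|vert J| ->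
  is_tree (edge_sub A) -> is_tree (edge_sub B) ->
  (forall a, embE f a \in A) ->
  (forall a, embV i (embV f a) = embV j (embV g a)) ->
  (forall u, (exists x, u = embV i x) \/ (exists y, u = embV j y)) ->
  (forall x y, embV i x = embV j y -> x \in codom (embV f)) ->
  (forall e, reflect ((exists2 y, y \in B & e = embE j y) \/
                      (exists2 x, (x \in A) && (x \notin codom (embE f)) &
                                  e = embE i x)) (e \in C)) ->
  is_tree (edge_sub C).
Proof.
move=> tJ /[dup] J0 /card_gt0P[a0 _] tA tB fA ij surj overlap CP.
have conY y y' : connect (@adj (edge_sub C)) (embV j y) (embV j y').
  move: (tB.1 y y'); apply: connect_homo => {}y {}y' /adj_edge_subP[e eB E].
  apply/connect1/adj_edge_subP; exists (embE j e); first by apply/CP; left; exists e.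
  by rewrite emb_ends E imsetU1 imset_set1.
have conX x x' : connect (@adj (edge_sub C)) (embV i x) (embV i x').
  move: (tA.1 x x'); apply: connect_homo => {}x {}x' /adj_edge_subP[e eA E].
  (* An edge of [A] coming from [J] may be absent from [C], but its ends also lie in the copy of
     [Y], where [conY] joins them. *)
  have [/codomP[a ea]|en] := boolP (e \in codom (embE f)); last first.
    apply/connect1/adj_edge_subP; exists (embE i e).
      by apply/CP; right; exists e; rewrite ?eA.
    by rewrite emb_ends E imsetU1 imset_set1.
  move: (emb_ends f a); rewrite -ea E => E'.
  have /imsetP[b _ ->] : x \in embV f @: ends a by rewrite -E' !inE eqxx.
  have /imsetP[b' _ ->] : x' \in embV f @: ends a by rewrite -E' !inE eqxx orbT.
  by rewrite !ij.
have con_a0 u : connect (@adj (edge_sub C)) (embV j (embV g a0)) u.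
  case: (surj u) => [[x ->]|[y ->]]; last exact: conY.
  by rewrite -ij; apply: conX.
have cC : connected (edge_sub C).
  move=> u v; apply: (@connect_trans _ _ (embV j (embV g a0))) => //.
  by rewrite connect_edge_sub_sym.
split=> //; apply: acyclic_card => //=; rewrite card_sig.
have cJ := tree_card tJ J0.
have cA : #|A|.+1 = #|vert X|.
  have := tree_card tA; rewrite /= card_sig; apply.
  by apply/card_gt0P; exists (embV f a0).
have cB : #|B|.+1 = #|vert Y|.
  have := tree_card tB; rewrite /= card_sig; apply.
  by apply/card_gt0P; exists (embV g a0).
pose fJ := [set embE f a | a : edge J].
have leC : #|C| <= #|B| + (#|A| - #|edge J|).
  rewrite -(card_imset (mem B) (@embE_inj _ _ j)).
  have -> : #|A| - #|edge J| = #|[set x in A] :\: fJ|.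
    rewrite cardsDS; last by apply/subsetP => _ /imsetP[a _ ->]; rewrite inE.
    by rewrite cardsE (card_imset _ (@embE_inj _ _ f)).
  rewrite -(card_imset (mem (_ :\: _)) (@embE_inj _ _ i)).
  apply: leq_trans (leq_card_setU _ _); apply/subset_leq_card/subsetP => e.
  rewrite inE => /CP[[y yB ->]|[x /andP[xA xn] ->]]; apply/orP; [left|right].
    exact: imset_f.
  apply: imset_f; rewrite !inE xA andbT.
  by apply: contra xn => /imsetP[a _ ->]; apply: codom_f.
(* Inclusion-exclusion: by [overlap], the two copies meet only in the image of [J]. *)
have geV : #|vert X| + #|vert Y| - #|vert J| <= #|vert H|.
  rewrite -!cardsT -(card_imset (mem [set: vert X]) (@embV_inj _ _ i)).
  rewrite -(card_imset (mem [set: vert Y]) (@embV_inj _ _ j)).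
  apply: (leq_trans _ (subset_leq_card (subsetT
    ([set embV i x | x in setT] :|: [set embV j y | y in setT])))).
  rewrite cardsU leq_sub2l // cardsT.
  rewrite -(card_codom (inj_comp (@embV_inj _ _ i) (@embV_inj _ _ f))).
  apply/subset_leq_card/subsetP => u; rewrite inE.
  case/andP => /imsetP[x _ ->] /imsetP[y _ /overlap/codomP[a ->]].
  exact: (codom_f (embV i \o embV f)).
have leJA : #|edge J| <= #|A|.
  rewrite -(card_codom (@embE_inj _ _ f)); apply/subset_leq_card/subsetP.
  by move=> _ /codomP[a ->].
have leJY : #|vert J| <= #|vert Y| by apply: leq_card (@embV_inj _ _ g).
(* The tree counts turn [leC] into [#|C| < #|vert X| + #|vert Y| - #|vert J|]; [leJA] and [leJY]
   make the truncated subtractions exact. *)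
move: cJ cA cB leC geV leJA leJY.
move: #|vert J| #|vert X| #|vert Y| #|vert H| #|A| #|B| #|C| #|edge J| => *; lia.
Qed.

(** * Pruning preserves trees *)

(** Adjacency within [W] stays a relation on [vert G], so that successive pruning rounds can be
    compared without changing the vertex type. *)
Definition adj_in (G : mgraph) (A : {pred edge G}) (W : {set vert G}) :
    rel (vert G) :=
  fun x y => [&& x \in W, y \in W & @adj (edge_sub A) x y].

Definition connected_in (G : mgraph) (A : {pred edge G}) (W : {set vert G}) :=
  {in W &, forall x y, connect (adj_in A W) x y}.

Lemma prune_step_connected (G : mgraph) (P : {set vert G}) (A : {pred edge G})
    (W : {set vert G}) :
  connected_in A W -> connected_in A (prune_step P W).
Proof.
set W' := prune_step P W => cW x y xW' yW'.
have sW v : v \in W' -> v \in W by rewrite inE => /andP[].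
(* The path is made simple, so that the two neighbors of each inner vertex on it differ. *)
have /connectP[p0 pp0 yp0] := cW x y (sW _ xW') (sW _ yW').
case/shortenP: pp0 yp0 => p pp up _ yp; apply/connectP; exists p => //.
move: yW'; rewrite {y}yp.
elim: p x pp up xW' => //= y p IH x /andP[/and3P[xW yW xy] pp] /andP[xp up] xW' lW'.
suff yW' : y \in W' by rewrite {1}/adj_in xW' yW' xy; apply: IH.
(* If [y] is the last vertex, it survives by assumption; otherwise it has a predecessor [x] and a
   successor [z]. *)
case: p pp xp lW' {IH up} => //= z p /andP[/and3P[_ zW yz] _].
rewrite !inE !negb_or => /and3P[nxy nxz _] _.
rewrite [y \in W]yW negb_and negbK; apply/orP; right.
have [e1 _ E1] := adj_edge_subP A x y xy.
have [e2 _ E2] := adj_edge_subP A y z yz.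
(* The edges to [x] and [z] are distinct because [x] is not an end of the second one. *)
rewrite neq_ltn; apply/orP; right; apply/card_gt1P; exists e1, e2; split.
- rewrite inE E1 !inE eqxx orbT; apply/subsetP => u.
  by rewrite !inE => /orP[]/eqP->.
- rewrite inE E2 !inE eqxx; apply/subsetP => u.
  by rewrite !inE => /orP[]/eqP->.
- apply/eqP => E; have : x \in ends e1 by rewrite E1 !inE eqxx.
  by rewrite E E2 !inE (negbTE nxy) (negbTE nxz).
Qed.

Lemma prune_connected (G : mgraph) (P : {set vert G}) (A : {pred edge G}) :
  connected (edge_sub A) -> connected_in A (prune P).
Proof.
move=> cA; rewrite /prune; elim: #|_| => [|n IH] /=; last exact: prune_step_connected.
move=> x y _ _; apply: connect_sub (cA x y) => u v uv.
by apply: connect1; rewrite /adj_in !inE.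
Qed.

Lemma vertex_sub_connected (G : mgraph) (A : {pred edge G}) (W : {set vert G}) :
  connected_in A W ->
  connected (@edge_sub (vertex_sub W) [pred e | val e \in A]).
Proof.
move=> cW x y; have /connectP[p] := cW _ _ (valP x) (valP y).
elim: p x => [|z p IH] x /=; first by move=> _ /val_inj ->.
case/andP => /and3P[_ zW /adj_edge_subP[e eA E]] pp yp.
apply: connect_trans (IH (exist _ z zW) pp yp); apply/connect1/adj_edge_subP.
have eW : ends e \subset W.
  rewrite E; apply/subsetP => u.
  by rewrite !inE => /orP[]/eqP->; rewrite ?(valP x).
exists (exist _ e eW); first by rewrite inE.
by apply/setP => u; rewrite !inE /= E !inE -!val_eqE.
Qed.

Lemma val_vertex_sub_ends (G : mgraph) (W : {set vert G})
    (e : edge (vertex_sub W)) :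
  ends (val e) = [set val x | x in ends e].
Proof.
apply/setP => u; apply/idP/imsetP => [ue|[x]]; last by rewrite inE => ? ->.
have uW : u \in W by apply: subsetP ue; exact: (valP e).
by exists (exist _ u uW); rewrite ?inE.
Qed.

(** Acyclicity is inherited because the pruned subgraph embeds in the original tree; only
    connectedness depends on how the pruning is done. *)
Lemma prune_tree (G : mgraph) (P : {set vert G}) (A : {pred edge G}) :
  is_tree (edge_sub A) ->
  is_tree (@edge_sub (vertex_sub (prune P)) [pred e | val e \in A]).
Proof.
move=> [cA aA]; split; first exact/vertex_sub_connected/prune_connected.
set H := edge_sub _.
pose fE (e : edge H) : edge (edge_sub A) := exist _ (val (val e)) (valP e).
have fE_inj : injective fE by move=> e e' /(congr1 val) /= /val_inj /val_inj.
apply: acyclic_emb aA.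
by apply: (@Emb H (edge_sub A) val fE val_inj) => //= e; exact: val_vertex_sub_ends.
Qed.

(** * Vertices of valence 1 *)

Lemma valence_vertex_sub (G : mgraph) (W : {set vert G})
    (v : vert (vertex_sub W)) :
  valence v = valence_in W (val v).
Proof.
rewrite /valence /valence_in -(card_imset _ val_inj); apply: eq_card => e.
rewrite inE; apply/imsetP/andP => [[e' + ->]|[ve eW]].
  by rewrite !inE => ->; split=> //; apply: (valP e').
by exists (exist _ e eW); rewrite ?inE.
Qed.

(** One more pruning round changes nothing, yet it would remove an unprotected vertex of valence
    1. *)
Lemma pruned_leaf (G : mgraph) (P : {set vert G})
    (v : vert (vertex_sub (prune P))) :
  valence v = 1 -> val v \in P.
Proof.
rewrite valence_vertex_sub => v1; have : val v \in prune_step P (prune P).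
  by rewrite prune_stable; apply: (valP v).
by rewrite inE v1 eqxx andbT negbK => /andP[].
Qed.

Lemma connected_edge (G : mgraph) (A : {pred edge G}) (x y : vert G) :
  connected (edge_sub A) -> x != y -> exists2 e, e \in A & x \in ends e.
Proof.
move=> cA xy; have /connectP[[|z p] /=] := cA x y.
  by move=> _ Exy; rewrite Exy eqxx in xy.
by case/andP=> /adj_edge_subP[e eA E] _ _; exists e => //; rewrite E !inE eqxx.
Qed.

(** The edge at [v] provides a second vertex, so each of the two connected subgraphs has an edge at
    [v]; both must be that same edge. *)
Lemma leaf_black (I J : mgraph) (G : bigraph I J) (v : vert (bg G)) :
  connected (black_blue G) -> connected (black_red G) -> valence v = 1 ->
  exists2 e : edge (bg G), v \in ends e & col e = Black.
Proof.
move=> cb cr /eqP/cards1P[e E].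
have onlye e' : v \in ends e' -> e' = e.
  by move=> ve; apply/eqP; rewrite -in_set1 -E inE.
have ve : v \in ends e by have := set11 e; rewrite -E inE.
have [u vu] : exists u, v != u.
  have /cards2P[x [y [xy _]]] : #|ends e| == 2 by rewrite card_ends.
  by have [->|vx] := eqVneq v x; [exists y | exists x].
have [e1 + /onlye E1] := connected_edge cb vu.
have [e2 + /onlye E2] := connected_edge cr vu.
rewrite E1 E2 !inE => br bb; exists e => //.
by case: (col e) br bb.
Qed.

(** * The two trees of the glued graph *)

(** This identifies a restriction in two stages, first to the kept edges and then to a color class,
    with a direct restriction. *)
Lemma edge_sub_tree (G : mgraph) (A B : {pred edge G})
    (B' : {pred edge (edge_sub A)}) :
  {subset B <= A} -> (forall e, (e \in B') = (val e \in B)) ->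
  is_tree (edge_sub B) -> is_tree (edge_sub B').
Proof.
move=> BA BB' [cB aB]; split=> [x y|].
  apply: connect_sub (cB x y) => u v /adj_edge_subP[e eB E].
  by apply/connect1/adj_edge_subP; exists (exist _ e (BA _ eB)); rewrite ?BB'.
have B'B (e : edge (edge_sub B')) : val (val e) \in B by rewrite -BB' (valP e).
pose fE e : edge (edge_sub B) := exist _ (val (val e)) (B'B e).
have fE_inj : injective fE by move=> e e' /(congr1 val) /= /val_inj /val_inj.
apply: acyclic_emb aB.
by apply: (@Emb (edge_sub B') (edge_sub B) id fE) => // e; rewrite imset_id.
Qed.

(** The color classes are taken before any deletion; an edge to be removed belongs to none of
    them. *)
Definition colored (J1 J2 J3 : mgraph) (Delta : bitree J2 J1)
    (Gamma : bitree J3 J2) (p : color -> bool) :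
    {pred edge (glued Delta Gamma)} :=
  [pred e | if glued_color e is Some c then p c else false].

Arguments colored {J1 J2 J3} Delta Gamma p.

Lemma glued_cases (J1 J2 J3 : mgraph) (Delta : bitree J2 J1)
    (Gamma : bitree J3 J2) (e : edge (glued Delta Gamma)) :
  [\/ exists a, [/\ e = embE (inDelta Delta Gamma) (embE (Defs.iota Delta) a),
                    e = embE (inGamma Delta Gamma) (embE (jota Gamma) a) &
        glued_color e = merge_color (col (embE (Defs.iota Delta) a))
                                    (col (embE (jota Gamma) a))],
      exists2 d, d \notin codom (embE (Defs.iota Delta)) &
        e = embE (inDelta Delta Gamma) d /\ glued_color e = Some (col d) |
      exists2 c, c \notin codom (embE (jota Gamma)) &
        e = embE (inGamma Delta Gamma) c /\ glued_color e = Some (col c)].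
Proof.
have overlap d c : embE (inDelta Delta Gamma) d = embE (inGamma Delta Gamma) c ->
    exists2 a, d = embE (Defs.iota Delta) a & c = embE (jota Gamma) a.
  exact: po_eq.
have glueE a : embE (inDelta Delta Gamma) (embE (Defs.iota Delta) a) =
               embE (inGamma Delta Gamma) (embE (jota Gamma) a).
  by apply: po_glue; apply: embE_inj.
have [[d ed]|[c ec]] : (exists d, e = embE (inDelta Delta Gamma) d) \/
    (exists c, e = embE (inGamma Delta Gamma) c) := po_surj _ e.
- have [/codomP[a da]|nd] := boolP (d \in codom (embE (Defs.iota Delta))).
    apply: Or31; exists a; rewrite ed da; split=> //.
    by rewrite /glued_color Delta_colorE glueE Gamma_colorE.
  apply: Or32; exists d => //; split=> //.
  rewrite ed /glued_color Delta_colorE /Gamma_color; case: pickP => //= c /eqP.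
  by move=> /esym/overlap[a da]; rewrite da codom_f in nd.
- have [/codomP[a ca]|nc] := boolP (c \in codom (embE (jota Gamma))).
    apply: Or31; exists a; rewrite ec ca -glueE; split=> //.
    by rewrite /glued_color Delta_colorE glueE Gamma_colorE.
  apply: Or33; exists c => //; split=> //.
  rewrite ec /glued_color Gamma_colorE /Delta_color; case: pickP => //= d /eqP.
  by move=> /overlap[a _ ca]; rewrite ca codom_f in nc.
Qed.

(** On [J2] the merged color is black or blue exactly when the [Gamma]-color is black. So
    [glue_tree] applies with all of the [Gamma]-tree and the part of the [Delta]-tree outside
    [J2]. *)
Lemma black_blue_tree (J1 J2 J3 : mgraph) (Delta : bitree J2 J1)
    (Gamma : bitree J3 J2) :
  is_tree J2 -> 0 < #|vert J2| ->
  is_tree (edge_sub (colored Delta Gamma black_or_blue)).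
Proof.
move=> tJ J0; have bD := bitreeP Delta; have bG := bitreeP Gamma.
apply: (glue_tree (f := Defs.iota Delta) (g := jota Gamma)
  (i := inDelta Delta Gamma) (j := inGamma Delta Gamma) tJ J0
  (bitree_black_blue bD) (bitree_black_blue bG)).
- exact: bitree_iota bD.
- by move=> a; apply: po_glue; apply: embV_inj.
- exact: po_surj.
- by move=> x y /po_eq[a -> _]; apply: codom_f.
- move=> e; rewrite inE; apply: (iffP idP).
    case: (glued_cases e) => [[a [_ E ->]]|[d nd [E ->]]|[c nc [E ->]]] ce.
    + left; exists (embE (jota Gamma) a); rewrite // inE.
      by case: (col _) ce; case: (col _).
    + by right; exists d; rewrite // nd andbT.
    + by left; exists c.
  case: (glued_cases e) => [[a [E1 E2 ->]]|[d nd [E ->]]|[c nc [E ->]]].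
  + case=> [[c' cb]|[d' /andP[_ nd']]]; last first.
      by rewrite E1 => /embE_inj Ed; rewrite -Ed codom_f in nd'.
    rewrite E2 => /embE_inj Ec; move: cb; rewrite -Ec inE.
    have := bitree_iota bD a; have := bitree_jota bG a.
    by case: (col _); case: (col _).
  + case=> [[c' _]|[d' /andP[dA _]]]; rewrite E; last by move/embE_inj->.
    by case/po_eq => a da; rewrite da codom_f in nd.
  + case=> [[c' cb]|[d' /andP[_ nd']]]; rewrite E; first by move/embE_inj->.
    by case/esym/po_eq => a da; rewrite da codom_f in nd'.
Qed.

(** The roles are exchanged: on [J2] the merged color is black or red exactly when the [Delta]-color
    is black. *)
Lemma black_red_tree (J1 J2 J3 : mgraph) (Delta : bitree J2 J1)
    (Gamma : bitree J3 J2) :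
  is_tree J2 -> 0 < #|vert J2| ->
  is_tree (edge_sub (colored Delta Gamma black_or_red)).
Proof.
move=> tJ J0; have bD := bitreeP Delta; have bG := bitreeP Gamma.
apply: (glue_tree (f := jota Gamma) (g := Defs.iota Delta)
  (i := inGamma Delta Gamma) (j := inDelta Delta Gamma) tJ J0
  (bitree_black_red bG) (bitree_black_red bD)).
- exact: bitree_jota bG.
- by move=> a; apply/esym/po_glue; apply: embV_inj.
- by move=> u; case: (po_surj (embV (jota Gamma)) u); [right|left].
- by move=> x y /esym/po_eq[a _ ->]; apply: codom_f.
- move=> e; rewrite inE; apply: (iffP idP).
    case: (glued_cases e) => [[a [E _ ->]]|[d nd [E ->]]|[c nc [E ->]]] ce.
    + left; exists (embE (Defs.iota Delta) a); rewrite // inE.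
      by case: (col _) ce; case: (col _).
    + by left; exists d.
    + by right; exists c; rewrite // nc andbT.
  case: (glued_cases e) => [[a [E1 E2 ->]]|[d nd [E ->]]|[c nc [E ->]]].
  + case=> [[d' db]|[c' /andP[_ nc']]]; last first.
      by rewrite E2 => /embE_inj Ec; rewrite -Ec codom_f in nc'.
    rewrite E1 => /embE_inj Ed; move: db; rewrite -Ed inE.
    have := bitree_iota bD a; have := bitree_jota bG a.
    by case: (col _); case: (col _).
  + case=> [[d' db]|[c' /andP[_ nc']]]; rewrite E; first by move/embE_inj->.
    by case/po_eq => a _ ca; rewrite ca codom_f in nc'.
  + case=> [[d' _]|[c' /andP[cA _]]]; rewrite E; last by move/embE_inj->.
    by case/esym/po_eq => a _ ca; rewrite ca codom_f in nc.
Qed.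

(** * From the glued graph to the bi-tree *)

Lemma diamond_tree (J1 J2 J3 : mgraph) (Delta : bitree J2 J1)
    (Gamma : bitree J3 J2) (p : color -> bool) :
  is_tree (edge_sub (colored Delta Gamma p)) ->
  is_tree (@edge_sub (bg (diamond Delta Gamma)) [pred e | p (col e)]).
Proof.
move=> tC; pose R := [pred e : edge (glued Delta Gamma) | isSome (glued_color e)].
have CR : {subset colored Delta Gamma p <= R}.
  by move=> e; rewrite !inE; case: (glued_color e).
apply: (@prune_tree _ _ [pred e : edge (recolored Delta Gamma) |
  p (odflt Black (glued_color (val e)))]).
apply: edge_sub_tree CR _ tC => e.
(* Kept edges have a color, so the default [Black] adds nothing to the color class. *)
have : isSome (glued_color (val e)) := valP e.
by rewrite !inE; case: (glued_color (val e)).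
Qed.

Theorem lemma4p2 (J1 J2 J3 : mgraph)
  (J1_tree : is_tree J1) (J1_nonempty : 0 < #|vert J1|)
  (J2_tree : is_tree J2) (J2_nonempty : 0 < #|vert J2|)
  (J3_tree : is_tree J3) (J3_nonempty : 0 < #|vert J3|)
  (Delta : bitree J2 J1) (Gamma : bitree J3 J2) :
  is_bitree (diamond Delta Gamma).
Proof.
have bD := bitreeP Delta; have bG := bitreeP Gamma.
have tb : is_tree (black_blue (diamond Delta Gamma)).
  exact/diamond_tree/black_blue_tree.
have tr : is_tree (black_red (diamond Delta Gamma)).
  exact/diamond_tree/black_red_tree.
split=> // [e|e|v v1].
(* If the edge also lies in [J2], being kept and black or blue in [Gamma] forces it to be black
   there, so the merged color is black or blue. *)
- have := iota_kept Delta Gamma e; have := bitree_iota bG e; rewrite inE /=.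
  have [[a [_ /embE_inj <- ->]]|[d nd [/esym/po_eq[a da]]]|
    [c _ [/embE_inj <- ->]]] //
    := glued_cases (embE (inGamma Delta Gamma) (embE (Defs.iota Gamma) e)).
    by case: (col _); case: (col _).
  by rewrite da codom_f in nd.
(* Likewise, a kept edge of [J2] that is black or red in [Delta] must be black there. *)
- have := jota_kept Delta Gamma e; have := bitree_jota bD e; rewrite inE /=.
  have [[a [/embE_inj <- _ ->]]|[d _ [/embE_inj <- ->]]|
    [c nc [/po_eq[a _ ca]]]] //
    := glued_cases (embE (inDelta Delta Gamma) (embE (jota Delta) e)).
    by case: (col _); case: (col _).
  by rewrite ca codom_f in nc.
- split; first exact: leaf_black tb.1 tr.1 v1.
  move: (pruned_leaf v1); rewrite inE => /orP[]/codomP[x vx]; [left|right].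
    by apply/codomP; exists x; apply: val_inj.
  by apply/codomP; exists x; apply: val_inj.
Qed.
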